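(* Let $G=(V,A,c,q)$ be a weighted digraph with linear costs $c$ and adjacent quadratic costs $q$, and let $s\in V$ be a source node. If $c,q\ge 0$ (componentwise), then the Adjacent Quadratic Dijkstra algorithm run on $(V,A,c,q,s)$ ends in a finite number of iterations and computes, for every arc $a=(i,j)\in A$, the cost of a minimum $s$-$a$-walk; that is, upon termination $D_a$ equals the minimum of $\mathrm{cost}(w)$ over all $s$-$a$-walks $w$ (with value $+\infty$ if there is no $s$-$a$-walk).
   Context: **Graph and costs.** $(V,A)$ is a finite digraph, with $A\subseteq V\times V$ and no self-loops. Each arc $(u,v)\in A$ has a real linear cost $c_{uv}=c((u,v))$. Each pair of consecutive arcs $((u,v),(v,w))\in A\times A$ has a real quadratic cost $q_{uvw}=q(u,v,w)=q((u,v),(v,w))$. Pairs of arcs that are not consecutive (the end node of the first is not the start node of the second) have zero quadratic cost. **Walks.** A walk is a tuple of nodes $(v_0,v_1,\dots,v_k)$ with $(v_{r},v_{r+1})\in A$ for all $0\le r<k$; nodes and arcs may repeat. For $a=(i,j)\in A$, an $s$-$a$-walk is a walk $(v_0,\dots,v_k)$, $k\ge1$, with $v_0=s$, $v_{k-1}=i$, $v_k=j$. The cost of a walk is $$\mathrm{cost}(v_0,\dots,v_k)=\sum_{r=0}^{k-1}c_{v_rv_{r+1}}+\sum_{r=1}^{k-1}q_{v_{r-1}v_rv_{r+1}}.$$ **Adjacent Quadratic Dijkstra algorithm** (input $V,A,c,q,s$). An artificial arc $(s,s)$, not belonging to $A$, is used for initialization, with the convention $q_{ssk}=0$ for every $k$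 with $(s,k)\in A$. The neighbors of a node $j$ are the nodes $k$ with $(j,k)\in A$. 1. Set $D_a\leftarrow+\infty$ for every $a\in A$; set $D_{(s,s)}\leftarrow 0$ and $Q\leftarrow\{(s,s)\}$. 2. While $Q\neq\emptyset$ (each execution of the loop body is one iteration): - choose $a=(i,j)\in\arg\min\{D_a:a\in Q\}$ (ties broken arbitrarily) and set $Q\leftarrow Q\setminus\{a\}$; - for each neighbor $k$ of $j$: if $D_a+c_{jk}+q_{ijk}<D_{(j,k)}$, then set $D_{(j,k)}\leftarrow D_a+c_{jk}+q_{ijk}$ and $Q\leftarrow Q\cup\{(j,k)\}$. 3. Return $D$. *)

(* Defs.v *)
From HB Require Import structures.
From mathcomp Require Import all_boot all_order all_algebra.
From mathcomp Require Import reals constructive_ereal.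

Set Implicit Arguments.
Unset Strict Implicit.
Unset Printing Implicit Defensive.

Import Order.TTheory GRing.Theory Num.Theory.

Local Open Scope ring_scope.

(* [A u v] means that (u, v) is an arc. The cost functions are total, but only
   the values [c u v] with [A u v], and [q u v w] with [A u v] and [A v w], are
   ever used; pairs of non-consecutive arcs have no quadratic cost. *)
Section Walks.
Variables (R : realType) (V : finType).
Variables (A : rel V) (c : V -> V -> R) (q : V -> V -> V -> R) (s : V).

(* A walk (v_0, ..., v_k) is the sequence [w] with [nth s w r = v_r] and
   [(size w).-1 = k]; [sorted A w] says that consecutive nodes form arcs. *)
Definition sa_walk (a : V * V) (w : seq V) : bool :=
  [&& (1 < size w)%N, sorted A w, nth s w 0 == s,
      nth s w (size w).-2 == a.1 & nth s w (size w).-1 == a.2].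

Definition cost (w : seq V) : R :=
  \sum_(0 <= r < (size w).-1) c (nth s w r) (nth s w r.+1) +
  \sum_(1 <= r < (size w).-1) q (nth s w r.-1) (nth s w r) (nth s w r.+1).

Definition is_min_walk_cost (a : V * V) (d : \bar R) : Prop :=
  (exists w, [/\ sa_walk a w, d = (cost w)%:E &
                 forall w', sa_walk a w' -> cost w <= cost w'])
  \/ ((forall w, ~~ sa_walk a w) /\ d = +oo%E).

End Walks.

Section Dijkstra.
Variables (R : realType) (V : finType).
Variables (A : rel V) (c : V -> V -> R) (q : V -> V -> V -> R) (s : V).

(* [D] is indexed by all pairs of nodes: the arcs and the artificial arc (s, s).
   At every other pair it keeps the value +oo and is never consulted. *)
Record state := State { D : {ffun V * V -> \bar R}; Q : {set V * V} }.

Definition init : state :=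
  State [ffun a => if a == (s, s) then 0%E else +oo%E] [set (s, s)].

(* Includes the convention q_{ssk} = 0 for the artificial arc (s, s), which is
   not an arc of [A] since [A] has no self-loops. *)
Definition q_art (i j k : V) : R :=
  if (i == s) && (j == s) then 0 else q i j k.

Definition relax (a : V * V) (st : state) (k : V) : state :=
  let: (i, j) := a in
  let d := (D st a + (c j k)%:E + (q_art i j k)%:E)%E in
  if (d < D st (j, k))%E then
    State [ffun b => if b == (j, k) then d else D st b] ((j, k) |: Q st)
  else st.

(* The relation leaves open both the choice of [a] among the minimizers and the
   order [ks] in which the neighbors of its end node are processed. *)
Definition iteration (st st' : state) : Prop :=
  exists (a : V * V) (ks : seq V),
    [/\ a \in Q st,
        forall b, b \in Q st -> (D st a <= D st b)%E,
        perm_eq ks (enum (A a.2)) &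
        st' = foldl (relax a) (State (D st) (Q st :\ a)) ks].

(* [run n] is the state after [n] iterations; a terminated run is continued by
   repeating its final state. *)
Definition execution (run : nat -> state) : Prop :=
  run 0 = init /\
  forall n, if Q (run n) == set0 then run n.+1 = run n
            else iteration (run n) (run n.+1).

(* Hence every finite partial run extends to an [execution]: the loop can only
   stop with [Q] empty. *)
Lemma iteration_exists (st : state) :
  Q st != set0 -> exists st', iteration st st'.
Proof.
case/set0Pn => a0 a0Q.
case: (Order.TotalTheory.arg_minP (D st) a0Q) => a aQ amin.
by exists (foldl (relax a) (State (D st) (Q st :\ a)) (enum (A a.2))), a,
  (enum (A a.2)); split.
Qed.

End Dijkstra.

(* Main.v *)
Require Import Defs.
From mathcomp Require Import all_boot all_order all_algebra.
From mathcomp Require Import reals constructive_ereal.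

Set Implicit Arguments.
Unset Strict Implicit.
Unset Printing Implicit Defensive.

Import Order.TTheory GRing.Theory Num.Theory.

Local Open Scope ring_scope.

(** The classical correctness argument of Dijkstra's algorithm carries over,
    with arcs in the role of nodes: the cost of appending an arc to a walk
    depends only on the last arc of the walk, so walks from [s] are paths in
    the graph whose nodes are the arcs, started at the artificial arc [(s, s)].

    Call an arc settled when its value is finite and it is not in the queue.
    Since the costs are nonnegative, every value offered by the extracted
    minimum [a] is at least [D a], whereas a settled arc has a value of at most
    [D a]. So settled arcs are never improved and never re-enter the queue,
    and each iteration settles one more arc ([settled_iteration]); as there are
    finitely many arcs, the queue becomes empty.

    Every finite value is the cost of some walk, and the arcs following a
    settled arc have been relaxed: both facts belong to the invariant [inv].
    When the queue is empty all arcs of finite value are settled, so the values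
    satisfy the triangle inequality along every arc, and induction along a walk
    shows that no walk is cheaper than the value of its last arc
    ([inv_le_cost]). A lower bound on the costs of all walks that is attained
    when finite is the minimum. *)

(** * Walks and their costs *)

Section Walks.
Variables (R : realType) (V : finType).
Variables (A : rel V) (c : V -> V -> R) (q : V -> V -> V -> R) (s : V).

Lemma sa_walk_seq2 k : A s k -> sa_walk A s (s, k) [:: s; k].
Proof. by move=> Ask; rewrite /sa_walk /= Ask !eqxx. Qed.

Lemma cost_seq2 k : cost c q s [:: s; k] = c s k.
Proof. by rewrite /cost /= big_nat1 big_geq // addr0. Qed.

(** The last two nodes of a walk are kept explicit: they are what its last arc
    and the effect of appending a node depend on. *)
Lemma sa_walk_rcons2E i j w i' j' : sa_walk A s (i, j) (rcons (rcons w i') j') =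
  [&& sorted A (rcons w i'), A i' j', head s (rcons w i') == s,
      i' == i & j' == j].
Proof.
rewrite /sa_walk !size_rcons /= !nth_rcons !size_rcons ltnS leqnn !eqxx ltnn.
case: w => [|x w] /=; rewrite ?andbT // !rcons_path last_rcons ?ltnn ?eqxx.
by rewrite -!andbA.
Qed.

Lemma sa_walk_rcons2 i j w : sa_walk A s (i, j) w ->
  exists w0, w = rcons (rcons w0 i) j.
Proof.
case/lastP: w => [//|w j']; case/lastP: w => [//|w i'].
by rewrite sa_walk_rcons2E => /and5P[_ _ _ /eqP -> /eqP ->]; exists w.
Qed.

Lemma sa_walk_arc a w : sa_walk A s a w -> A a.1 a.2.
Proof.
case: a => i j ww; have [w0 w0E] := sa_walk_rcons2 ww.
by move: ww; rewrite w0E sa_walk_rcons2E => /and5P[].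
Qed.

Lemma sa_walk_rcons i j k w : A j k ->
  sa_walk A s (i, j) w -> sa_walk A s (j, k) (rcons w k).
Proof.
move=> Ajk ww; have [w0 w0E] := sa_walk_rcons2 ww.
move: ww; rewrite w0E !sa_walk_rcons2E Ajk !eqxx !andbT.
case/and3P; case: w0 {w0E} => [|x w0] /=;
  by rewrite ?rcons_path ?last_rcons => Aw Aij ->; rewrite ?Aw Aij.
Qed.

Lemma cost_rcons i j k w : sa_walk A s (i, j) w ->
  cost c q s (rcons w k) = cost c q s w + c j k + q i j k.
Proof.
case/sa_walk_rcons2 => w0 ->; rewrite /cost !size_rcons /=.
rewrite big_nat_recr // [in X in _ + X = _]big_nat_recr //=.
rewrite !nth_rcons !size_rcons !ltnS !leqnn ltnn !eqxx /=.
rewrite leqnSn -!addrA; congr (_ + _).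
  apply: eq_big_nat => r /andP[_ rw]; rewrite !(nth_rcons _ (rcons _ j)).
  have rw1 : (r.+1 < (size w0).+2)%N := rw.
  by rewrite !size_rcons rw1 (ltnW rw1).
rewrite addrCA; congr (_ + _).
apply: eq_big_nat => r /andP[_ rw]; rewrite !(nth_rcons _ (rcons _ j)).
have rw1 : (r.+1 < (size w0).+2)%N := rw.
by rewrite !size_rcons rw1 (ltnW rw1) (leq_ltn_trans (leq_pred r) (ltnW rw1)).
Qed.

(** Walks grow at their end because the cost of a new arc depends on the last
    arc only. *)
Lemma sa_walk_ind (P : V * V -> seq V -> Prop) :
  (forall k, A s k -> P (s, k) [:: s; k]) ->
  (forall i j k w, sa_walk A s (i, j) w -> A j k ->
     P (i, j) w -> P (j, k) (rcons w k)) ->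
  forall a w, sa_walk A s a w -> P a w.
Proof.
move=> P2 PS [i j] w; elim/last_ind: w i j => [//|w k' IH] j k ww.
have [w0 /rcons_inj[wE k'E]] := sa_walk_rcons2 ww; subst w k'.
case/lastP: w0 IH ww => [|w0 i] IH; rewrite sa_walk_rcons2E.
  by case/and5P=> _ Ajk /= /eqP js _ _; move: Ajk; rewrite js; exact: P2.
case/and5P=> Aw Ajk w0s _ _.
suff ww : sa_walk A s (i, j) (rcons (rcons w0 i) j) by apply: PS (IH _ _ ww).
rewrite sa_walk_rcons2E !eqxx !andbT.
case: w0 Aw w0s {IH} => [|x w0] /=; first by rewrite andbT => -> ->.
by rewrite !rcons_path last_rcons => /andP[-> ->] ->.
Qed.

End Walks.

(** * The effect of one iteration *)

Section Iteration.
Variables (R : realType) (V : finType).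
Variables (A : rel V) (c : V -> V -> R) (q : V -> V -> V -> R) (s : V).
Hypothesis A_loopless : irreflexive A.

Definition offer (x : \bar R) (a : V * V) (ks : seq V) (b : V * V) : \bar R :=
  if (b.1 == a.2) && (b.2 \in ks)
  then (x + (c a.2 b.2)%:E + (q_art q s a.1 a.2 b.2)%:E)%E else +oo%E.

Lemma offer_cons x a k ks b :
  offer x a (k :: ks) b = Order.min (offer x a [:: k] b) (offer x a ks b).
Proof.
rewrite /offer !inE; case: (b.1 == a.2) => //=.
case: (b.2 == k) => /=; last by rewrite min_r ?leey.
by case: ifP => _; rewrite ?minxx // min_l ?leey.
Qed.

Lemma relaxE a k st (st' := relax c q s a st k) :
  (forall b, D st' b = Order.min (D st b) (offer (D st a) a [:: k] b)) /\
  (forall b, (b \in Q st') =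
    (b \in Q st) || (offer (D st a) a [:: k] b < D st b)%E).
Proof.
rewrite {}/st' /relax /offer; case: a => i j /=.
case: ltP => xD /=; split=> -[u v] /=;
  rewrite ?ffunE ?in_setU1 ?inE ?xpair_eqE /=;
  case: andP => [[/eqP -> /eqP ->]|_] /=.
- by rewrite min_r // ltW.
- by rewrite min_l ?leey.
- by rewrite xD orbT.
- by rewrite ltNge leey orbF.
- by rewrite min_l.
- by rewrite min_l ?leey.
- by rewrite ltNge xD orbF.
- by rewrite ltNge leey orbF.
Qed.

(** The value of [a] is read afresh at each relaxation. It stays the same: a
    relaxed arc starts at [a.2], so it can be [a] only if it ends at [a.2],
    which the hypothesis excludes. *)
Lemma foldl_relaxE a ks st (st' := foldl (relax c q s a) st ks) :
  a.2 \notin ks ->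
  (forall b, D st' b = Order.min (D st b) (offer (D st a) a ks b)) /\
  (forall b, (b \in Q st') =
    (b \in Q st) || (offer (D st a) a ks b < D st b)%E).
Proof.
rewrite {}/st'; elim: ks st => [|k ks IH] st /=.
  by rewrite /offer => _; split=> b;
    rewrite in_nil andbF ?min_l ?ltNge ?leey ?orbF.
rewrite inE negb_or => /andP[a2k /IH{}IH].
have [DE QE] := relaxE a k st; have [DE' QE'] := IH (relax c q s a st k).
have DaE : D (relax c q s a st k) a = D st a.
  by rewrite DE /offer inE (negPf a2k) andbF min_l ?leey.
split=> b; first by rewrite DE' DaE DE -minA -offer_cons.
rewrite QE' DaE QE DE -orbA (offer_cons _ _ k ks); congr (_ || _).
rewrite gt_min lt_min; case: ltP => //= Do1.
by case: (ltP _ (D st b)) => //= /lt_le_trans; apply.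
Qed.

(** What [a] offers to [b] over the whole iteration, as a function of the graph
    instead of the list of neighbors. *)
Definition extension (x : \bar R) (a b : V * V) : \bar R :=
  if (b.1 == a.2) && A b.1 b.2
  then (x + (c a.2 b.2)%:E + (q_art q s a.1 a.2 b.2)%:E)%E else +oo%E.

(** An arc receives at most one offer per iteration, so the order in which the
    neighbors are processed leaves no trace in the resulting state. *)
Lemma iterationE st st' : iteration A c q s st st' -> exists a,
  [/\ a \in Q st, forall b, b \in Q st -> (D st a <= D st b)%E,
      forall b, D st' b = Order.min (D st b) (extension (D st a) a b) &
      forall b, (b \in Q st') =
        (b != a) && (b \in Q st) || (extension (D st a) a b < D st b)%E].
Proof.
case=> a [ks [aQ amin /perm_mem ksE ->]]; exists a.
have ksA k : (k \in ks) = A a.2 k by rewrite ksE mem_enum.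
have a2ks : a.2 \notin ks by rewrite ksA A_loopless.
have [DE QE] := foldl_relaxE (State (D st) (Q st :\ a)) a2ks.
have nE b : extension (D st a) a b = offer (D st a) a ks b.
  by rewrite /extension /offer ksA; case: eqVneq => //= ->.
by split=> // b; rewrite nE (DE, QE) //= in_setD1.
Qed.

End Iteration.

(** * Settled arcs and the invariant *)

Section Invariant.
Variables (R : realType) (V : finType).
Variables (A : rel V) (c : V -> V -> R) (q : V -> V -> V -> R) (s : V).

(** In a state reached by the algorithm these are the arcs extracted so far;
    reading them off the state makes it unnecessary to record the history. *)
Definition settled (st : state R V) : {set V * V} :=
  [set a | (D st a < +oo)%E & a \notin Q st].

Record inv (st : state R V) : Prop := Inv {
  inv_source : D st (s, s) = 0%E;
  inv_queue : forall b, b \in Q st -> (D st b < +oo)%E;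
  inv_walk : forall b, (D st b < +oo)%E ->
    b = (s, s) \/ exists2 w, sa_walk A s b w & D st b = (cost c q s w)%:E;
  inv_min : forall a b, a \in settled st -> b \in Q st -> (D st a <= D st b)%E;
  inv_relaxed : forall a k, a \in settled st -> A a.2 k ->
    (D st (a.2, k) <= D st a + (c a.2 k)%:E + (q_art q s a.1 a.2 k)%:E)%E }.

Lemma inv_init : inv (init R s).
Proof.
have finE b : ((D (init R s) b < +oo)%E) = (b == (s, s)).
  by rewrite ffunE; case: eqP; rewrite ?ltxx ?ltry.
have none a : a \in settled (init R s) = false.
  by rewrite in_set finE in_set1 andbN.
split=> [|b|b|a b|a k]; rewrite ?none //.
- by rewrite ffunE eqxx.
- by rewrite finE in_set1.
- by rewrite finE => /eqP; left.
Qed.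

Hypothesis A_loopless : irreflexive A.
Hypothesis c_ge0 : forall u v, A u v -> 0 <= c u v.
Hypothesis q_ge0 : forall u v w, A u v -> A v w -> 0 <= q u v w.

Lemma q_art_walk a w k : sa_walk A s a w ->
  q_art q s a.1 a.2 k = q a.1 a.2 k.
Proof.
move/sa_walk_arc; rewrite /q_art; case: ifP => // /andP[/eqP -> /eqP ->].
by rewrite A_loopless.
Qed.

(** The one place where the signs of the costs matter: walking on from [a]
    never gets cheaper than [a]. *)
Lemma le_extension st a b : inv st -> (D st a < +oo)%E ->
  (D st a <= extension A c q s (D st a) a b)%E.
Proof.
move=> I Da; rewrite /extension; case: ifP => [/andP[/eqP b1 Ab]|_];
  last exact: leey.
rewrite b1 in Ab; rewrite -addeA leeDl // -EFinD lee_fin addr_ge0 ?c_ge0 //.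
case: (inv_walk I Da) => [->|[w ww _]]; first by rewrite /q_art !eqxx.
by rewrite (q_art_walk _ ww) q_ge0 // (sa_walk_arc ww).
Qed.

Lemma extension_walk st a b (x := extension A c q s (D st a) a b) :
  inv st -> (D st a < +oo)%E -> (x < +oo)%E ->
  exists2 w, sa_walk A s b w & x = (cost c q s w)%:E.
Proof.
rewrite {}/x /extension => I Da; case: b => j k /=.
case: ifP => [/andP[/eqP -> Ajk] _|]; last by rewrite ltxx.
case: (inv_walk I Da) => [aE|[w ww ->]].
  rewrite aE /= in Ajk *; exists [:: s; k]; first exact: sa_walk_seq2.
  by rewrite cost_seq2 inv_source // /q_art !eqxx add0e adde0.
rewrite (q_art_walk _ ww); case: a {Da} ww Ajk => i j' /= ww Ajk.
by exists (rcons w k); [exact: sa_walk_rcons ww|rewrite (cost_rcons _ _ _ ww)].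
Qed.

(** Nothing offered undercuts the extracted minimum, so neither the settled
    arcs nor the minimum itself are improved or queued again. *)
Lemma settled_iteration st st' : inv st -> iteration A c q s st st' ->
  inv st' /\ settled st \proper settled st'.
Proof.
move=> I /(iterationE A_loopless)[a [aQ amin DE QE]].
have Da := inv_queue I aQ.
have le_ext b := le_extension b I Da.
set ext := extension A c q s (D st a) a in le_ext DE QE.
have fixed b : (D st b <= D st a)%E -> D st' b = D st b.
  by move=> ba; rewrite DE min_l // (le_trans ba).
have le_settled b : b \in settled st -> (D st b <= D st a)%E.
  by move=> bS; exact: inv_min aQ.
have settledE b : (b \in settled st') = (b == a) || (b \in settled st).
  rewrite !inE QE DE gt_min; case: (eqVneq b a) => [->|ba] /=.
    by rewrite Da /= -leNgt le_ext.
  (* An improved arc cannot have been settled; any other arc keeps its value. *)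
  case: (ltP (ext b) (D st b)) => [lt_b|le_b]; last first.
    rewrite orbF; case: ltP => //= Dboo; apply/negbTE; rewrite negb_and.
    by rewrite -leNgt (le_trans Dboo le_b).
  rewrite orbT andbF; apply/esym/negP => bS.
  have bs : b \in settled st by rewrite inE.
  by have := lt_le_trans lt_b (le_settled _ bs); rewrite ltNge le_ext.
have le_new b : b \in Q st' -> (D st a <= D st' b)%E.
  rewrite QE DE le_min le_ext andbT => /orP[/andP[_ /amin]//|/ltW].
  exact: le_trans (le_ext b).
have le_settled' b : b \in settled st' -> (D st b <= D st a)%E.
  by rewrite settledE => /orP[/eqP ->|/le_settled].
split; first split.
- have := DE (s, s); rewrite /ext /extension /= A_loopless andbF min_l ?leey //.
  by rewrite (inv_source I).
- move=> b; rewrite QE DE gt_min => /orP[/andP[_ /(inv_queue I) ->]//|].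
  by move/lt_le_trans => ->; rewrite ?orbT ?leey.
- move=> b; rewrite DE; case: (leP (D st b) (ext b)) => _; first exact: inv_walk.
  by move=> /(extension_walk I Da); right.
- move=> b e bS' /le_new; rewrite (fixed b) ?le_settled' //.
  exact: le_trans (le_settled' _ bS').
- move=> b k bS' Abk; rewrite (fixed b) ?le_settled' // DE ge_min.
  move: bS' Abk; rewrite settledE => /orP[/eqP ->|bS] Abk; last first.
    by rewrite (inv_relaxed I bS Abk).
  by rewrite /ext /extension /= eqxx Abk lexx orbT.
apply/properP; split; first by apply/subsetP=> b bS; rewrite settledE bS orbT.
by exists a; rewrite ?settledE ?eqxx // inE aQ andbF.
Qed.

(** An empty queue makes every arc of finite value settled, hence relaxed, so
    finiteness of the value propagates along the walk with the bound. *)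
Lemma inv_le_cost st a w : inv st -> Q st = set0 -> sa_walk A s a w ->
  (D st a <= (cost c q s w)%:E)%E.
Proof.
move=> I Q0; have settledE b : (b \in settled st) = (D st b < +oo)%E.
  by rewrite !inE Q0 in_set0 andbT.
elim/sa_walk_ind: w / => [k Ask|i j k w ww Ajk IH].
  have := @inv_relaxed _ I (s, s) k.
  rewrite settledE inv_source // ltry => /(_ isT Ask).
  by rewrite cost_seq2 /q_art /= !eqxx add0e adde0.
have ijS : (i, j) \in settled st by rewrite settledE (le_lt_trans IH) ?ltry.
apply: le_trans (inv_relaxed I ijS Ajk) _.
by rewrite (q_art_walk _ ww) (cost_rcons _ _ _ ww) !EFinD !leeD.
Qed.

Lemma execution_terminates run : execution A c q s run ->
  exists2 n, Q (run n) = set0 & inv (run n).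
Proof.
case=> run0 runS.
have step n : inv (run n) /\ (Q (run n) = set0 \/ (n <= #|settled (run n)|)%N).
  elim: n => [|n [I nS]]; first by rewrite run0; split; [exact: inv_init|right].
  have := runS n; case: eqVneq nS => [Q0 _ ->|Qn0 nS it].
    by split=> //; left.
  have [I' /proper_card lt_S] := settled_iteration I it.
  by split=> //; right; case: nS Qn0 => [->|/leq_ltn_trans nS _];
    [rewrite eqxx|exact: nS].
have [I [Q0|]] := step #|{: V * V}|.+1; first by exists #|{: V * V}|.+1.
by rewrite ltnNge max_card.
Qed.

End Invariant.

Theorem proposition1 (R : realType) (V : finType) (A : rel V)
    (c : V -> V -> R) (q : V -> V -> V -> R) (s : V)
    (A_loopless : irreflexive A)
    (c_ge0 : forall u v, A u v -> 0 <= c u v)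
    (q_ge0 : forall u v w, A u v -> A v w -> 0 <= q u v w) :
  forall run : nat -> state R V, execution A c q s run ->
    exists n : nat,
      Q (run n) = set0 /\
      forall i j, A i j -> is_min_walk_cost A c q s (i, j) (D (run n) (i, j)).
Proof.
move=> run /(execution_terminates A_loopless c_ge0 q_ge0)[n Q0 I].
exists n; split=> // i j Aij.
have le_cost w := inv_le_cost A_loopless I Q0 (w := w).
case: (ltP (D (run n) (i, j)) +oo%E) => Dij; last first.
  right; split; last by apply/eqP; rewrite -leye_eq.
  move=> w; apply/negP => /le_cost/(le_trans Dij).
  by rewrite leNgt ltry.
left; case: (inv_walk I Dij) => [[ijs js]|[w ww DE]].
  by rewrite ijs js A_loopless in Aij.
by exists w; split=> // w' /le_cost; rewrite DE lee_fin.
Qed.
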